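(* Let $m\ge2$, let $J:=\{1,\dots,m\}$ and suppose $\{C_j\}_{j\in J}$ is a finite collection of nonempty union convex sets in $X$. Consider a sequence $(x_n)_{n\in\mathbb{N}}$ with $x_0\in X$ satisfying $$\forall n\in\mathbb{N},\quad x_{n+1}\in T_{C_1,C_{i_n}}(x_n)\quad\text{where } i_n=\left(n\bmod(m-1)\right)+2.$$ If $x^*\in\bigcap_{j\in J\setminus\{1\}}\mathbf{Fix}\,T_{C_1,C_j}$ (in particular, if $x^*\in\bigcap_{j\in J}C_j$), then there exists an $r>0$ such that the sequence $(x_n)_{n\in\mathbb{N}}$ converges to a point $\overline{x}\in\bigcap_{j\in J\setminus\{1\}}\operatorname{Fix}T_{C_1,C_j}$ whenever $x_0\in\operatorname{int}\mathbb{B}(x^*;r)$. Moreover, if the set $C_1$ is convex, then $P_{C_1}(\overline{x})\in\bigcap_{j\in J}C_j$.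
   Context: $X$ is a real finite-dimensional Hilbert space with norm $\|\cdot\|$. A set is union convex if it is a finite union of closed convex sets. For a nonempty set $C\subseteq X$, $P_C(x):=\{c\in C:\|x-c\|=\inf_{c'\in C}\|x-c'\|\}$ (single-valued when $C$ is closed and convex, and then identified with its unique element). For nonempty sets $A,B$, the Douglas--Rachford operator is $T_{A,B}(x):=\{x+b-a:a\in P_A(x),\ b\in P_B(2a-x)\}$. For $T\colon X\rightrightarrows X$, $\operatorname{Fix}T:=\{x:x\in T(x)\}$ and $\mathbf{Fix}\,T:=\{x:T(x)=\{x\}\}$. $\mathbb{B}(x;r)$ is the closed ball of center $x$ and radius $r$. $n\bmod k\in\{0,\dots,k-1\}$ is the remainder of $n$ on division by $k$. *)

(* Defs.v *)
From HB Require Import structures.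
From mathcomp Require Import all_boot all_order all_algebra.
From mathcomp Require Import all_classical all_reals all_analysis.

Set Implicit Arguments.
Unset Strict Implicit.
Unset Printing Implicit Defensive.

Import Order.TTheory GRing.Theory Num.Theory.
Import numFieldNormedType.Exports.

Local Open Scope classical_set_scope.
Local Open Scope ring_scope.

(* With an inner product [dot : {dot X for idfun}] inducing the norm, a
   [normedVectType R] is a real finite-dimensional Hilbert space (completeness
   is automatic in finite dimension). *)
#[short(type="normedVectType")]
HB.structure Definition NormedVector (R : realType) :=
  {X of NormedModule R X & Vector R X}.

Section DouglasRachford.
Context {R : realType} {X : normedModType R}.
Implicit Types (A B C : set X) (x : X).

Definition union_convex A : Prop :=
  exists (k : nat) (D : 'I_k -> set X),
    (forall i, closed (D i) /\ convex_set (D i)) /\ A = \bigcup_i D i.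

Definition metric_proj C x : set X :=
  [set c | C c /\ `|x - c| = inf [set `|x - c'| | c' in C]].

Definition douglas_rachford A B x : set X :=
  [set x + ab.2 - ab.1 | ab in
     [set ab : X * X | metric_proj A x ab.1 /\
                       metric_proj B (2 *: ab.1 - x) ab.2]].

End DouglasRachford.

(* Set-valued maps are functions [T : X -> set X]. *)
Definition fix_points {X : Type} (T : X -> set X) : set X :=
  [set x | T x x].

Definition strong_fix_points {X : Type} (T : X -> set X) : set X :=
  [set x | T x = [set x]].

Definition index_set (m : nat) : set nat := [set j | (1 <= j <= m)%N].

(* Main.v *)
Require Import Defs.
From HB Require Import structures.
From mathcomp Require Import all_boot all_order all_algebra.
From mathcomp Require Import all_classical all_reals all_analysis.
From mathcomp Require Import ring lra.

Set Implicit Arguments.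
Unset Strict Implicit.
Unset Printing Implicit Defensive.

Import Order.TTheory GRing.Theory Num.Theory.
Import numFieldNormedType.Exports.

Local Open Scope classical_set_scope.
Local Open Scope ring_scope.

(** The mechanism is that every Douglas-Rachford operator [T] between union
    convex sets is firmly nonexpansive _near_ each point [y], up to a choice:
    for [x] close to [y], every [z] in [T x] has a partner [w] in [T y] with
      |z - w|^2 + |(x - z) - (y - w)|^2 <= |x - y|^2,
    and [T y] is finite.  This is [douglas_rachford_locally_firm] together with
    [douglas_rachford_finite].  For a metric projection it holds because a piece
    [D i] of [C] that does not come closest to [y] is not closest to any [x] near
    [y] either ([metric_proj_active]).  A point of [D i] projecting such an [x]
    therefore has a partner in the same convex set [D i], and projections onto
    one convex set are firmly nonexpansive ([metric_proj_firm]).  The composition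
    defining [T] preserves this as in the convex case
    ([firm_douglas_rachford]).

    Convergence ([locally_firm_orbit_cvg]) uses the property at two points.  At
    the common strong fixed point [xstar] the only possible partner is [xstar]
    itself.  So an orbit that starts close to [xstar] never increases its distance to [xstar],
    and the squared step lengths are bounded by the decrease of the squared
    distance; hence the steps tend to 0.  By compactness the orbit has a cluster
    point [y].  At [y] the partners lie in the finite union of the sets
    [T_j y].  Once the orbit is close to [y] and its steps are short, the partner
    of [x n.+1] is so close to [y] that finiteness forces it to be [y].  Then [y]
    is a fixed point of the operator in use and [x n.+1] is no farther from [y]
    than [x n] is.  Hence the orbit stays near [y], converges to [y], and [y] is
    fixed by every operator that is used infinitely often, whatever choices the
    set-valued operators make along the way.

    Finally, if [x] belongs to [T_{A,B} x], then some projection of [x] onto [A]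
    lies in [B].  If [C 1] is convex, this projection is the same point for all
    [j], and so it lies in all the sets. *)

(** * Compactness in finite dimension *)

Section Compactness.
Import VectorInternalTheory.
Context {R : realType} {X : normedVectType R}.

Lemma coord_le_mx_norm n (u : 'rV[R]_n) i : `|u 0 i| <= `|u|.
Proof.
rewrite [leRHS]/Num.norm /= mx_normrE.
by apply/bigmax_geP; right; exists (0, i).
Qed.

Lemma r2v_continuous : continuous (r2v : 'rV[R]_(dim X) -> X).
Proof.
apply: (@bounded_linear_continuous _ _ _ (r2v : {linear 'rV[R]_(dim X) -> X})).
apply/linear_boundedP.
exists (\sum_i `|r2v (delta_mx 0 i) : X|); split=> [|r /ltW Mr u /=].
  exact: num_real.
apply: (@le_trans _ _ ((\sum_i `|r2v (delta_mx 0 i) : X|) * `|u|)); last first.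
  by rewrite ler_wpM2r.
rewrite [in leLHS](row_sum_delta u) linear_sum/= mulr_suml.
apply: le_trans (ler_norm_sum _ _ _) _; apply: ler_sum => i _.
by rewrite linearZ/= normrZ mulrC ler_wpM2l// coord_le_mx_norm.
Qed.

(** The image of the unit sphere under the coordinate isomorphism is compact and
    misses 0, so it stays away from 0: with [r2v_continuous] this makes the norm
    of the space equivalent to the norm of coordinates. *)
Lemma r2v_lower_bound :
  exists2 e : R, 0 < e & forall u : 'rV[R]_(dim X), e * `|u| <= `|r2v u : X|.
Proof.
pose S := [set u : 'rV[R]_(dim X) | `|u| = 1].
have Scomp : compact S.
  apply: bounded_closed_compact.
    by exists 1; split=> [|r r1 u /= ->]; [exact: num_real|exact: ltW].
  rewrite (_ : S = Num.norm @^-1` [set 1 : R])//.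
  by apply: preimage_closed => [u _|]; [exact: norm_continuous|exact: closed_eq].
have imS : closed (r2v @` S : set X).
  apply: compact_closed; first exact: norm_hausdorff.
  apply: continuous_compact => //.
  by apply: continuous_subspaceT; exact: r2v_continuous.
have : nbhs (0 : X) (~` (r2v @` S)).
  apply: open_nbhs_nbhs; split; first exact: closed_openC.
  move=> [u Su /eqP]; rewrite -(linear0 r2v) (can_eq r2vK) => /eqP u0.
  by move: Su; rewrite /S/= u0 normr0 => /esym/eqP; rewrite oner_eq0.
move=> /nbhs_normP[e /= e0 He]; exists e => // u.
have [->|u0] := eqVneq u 0; first by rewrite normr0 mulr0.
have nu : 0 < `|u| by rewrite normr_gt0.
rewrite -ler_pdivlMr// leNgt; apply/negP => lte.
apply: (He (r2v (`|u|^-1 *: u))) => /=.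
  by rewrite sub0r normrN linearZ/= normrZ normfV normr_id mulrC.
by exists (`|u|^-1 *: u) => //; rewrite /S/= normrZ normfV normr_id mulVf// gt_eqF.
Qed.

Lemma bounded_closed_compact_vect (A : set X) :
  bounded_set A -> closed A -> compact A.
Proof.
move=> [M [_ AM]] Acl; have [e e0 He] := r2v_lower_bound.
rewrite (_ : A = r2v @` (r2v @^-1` A)); last first.
  apply/seteqP; split=> [x Ax|_ [u Au <-]//].
  by exists (v2r x); rewrite /= v2rK.
apply: continuous_compact.
  by apply: continuous_subspaceT; exact: r2v_continuous.
apply: bounded_closed_compact.
  exists ((M + 1) / e); split=> [|r Mr u /= Au]; first exact: num_real.
  apply/ltW; apply: le_lt_trans Mr; rewrite ler_pdivlMr// mulrC.
  by apply: le_trans (He u) _; apply: AM Au; rewrite ltrDl.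
by apply: preimage_closed => // u _; exact: r2v_continuous.
Qed.

Lemma closed_ball_compact (x : X) (r : R) :
  compact (closed_ball_ Num.norm x r).
Proof.
apply: bounded_closed_compact_vect; last exact: closed_closed_ball_.
exists (`|x| + r); split=> [|s rs y yx]; first exact: num_real.
apply/ltW/(le_lt_trans _ rs); rewrite -[y](subKr x).
by apply: le_trans (ler_normB _ _) _; rewrite lerD2l.
Qed.

End Compactness.


(** * Metric projections *)

Section MetricProjection.
Context {R : realType}.

Lemma metric_projP {X : normedModType R} (C : set X) x c :
  metric_proj C x c <-> C c /\ forall c', C c' -> `|x - c| <= `|x - c'|.
Proof.
have lbC : has_lbound [set `|x - c'| | c' in C] by exists 0 => _ [c' _ <-].
split=> [[Cc ->]|[Cc minc]]; split=> //.
  by move=> c' Cc'; apply: ge_inf => //; exists c'.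
apply/eqP; rewrite eq_le; apply/andP; split; last by apply: ge_inf => //; exists c.
by apply: lb_le_inf; [exists `|x - c|, c|move=> _ [c' Cc' <-]; exact: minc].
Qed.

Lemma metric_proj_subset {X : normedModType R} (C D : set X) x c :
  D `<=` C -> D c -> metric_proj C x c -> metric_proj D x c.
Proof.
move=> DC Dc /metric_projP[_ minc]; apply/metric_projP; split=> // c' Dc'.
exact/minc/DC.
Qed.

Lemma metric_proj_id {X : normedModType R} (C : set X) x :
  C x -> metric_proj C x = [set x].
Proof.
move=> Cx; apply/seteqP; split=> [c /metric_projP[_ /(_ _ Cx)]|_ ->].
  by rewrite subrr normr0 normr_le0 subr_eq0 => /eqP ->.
by apply/metric_projP; split=> // c _; rewrite subrr normr0.
Qed.

Lemma metric_proj_exists {X : normedVectType R} (D : set X) x :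
  closed D -> D !=set0 -> metric_proj D x !=set0.
Proof.
move=> Dcl [c0 Dc0].
pose K := D `&` closed_ball_ Num.norm x `|x - c0|.
have cK : continuous (fun y : X => `|x - y|).
  move=> y; apply: (@continuous_comp _ _ _ (fun y : X => x - y) Num.norm).
    by apply: cvgB; [exact: cvg_cst|exact: cvg_id].
  exact: norm_continuous.
have Kcomp : compact K.
  apply: subclosed_compact (@closed_ball_compact _ _ x `|x - c0|) _.
    by apply: closedI => //; exact: closed_closed_ball_.
  by move=> y [].
have [] := compact_EVT_min _ Kcomp (continuous_subspaceT cK).
  by exists c0; split=> //=; exact: lexx.
move=> p /[!inE] -[Dp px] minp; exists p; apply/metric_projP; split=> // c Dc.
have [xc|xc] := leP `|x - c| `|x - c0|; first by apply: minp; rewrite inE.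
exact: le_trans px (ltW xc).
Qed.

(** Let [w] project [y] onto the union.  If a piece contains no projection of
    [y], its distance to [y] exceeds [`|y - w|] by a positive gap.  A
    displacement of [y] by less than half of the gap changes neither distance
    enough for the piece to become closest; there are finitely many pieces. *)
Lemma metric_proj_active {X : normedVectType R} k (D : 'I_k -> set X) y :
    (forall i, closed (D i)) ->
  \forall x \near y, forall i c, D i c -> metric_proj (\bigcup_i D i) x c ->
    exists2 p, D i p & metric_proj (\bigcup_i D i) y p.
Proof.
move=> Dcl; set C := \bigcup_i D i.
have Ccl : closed C by apply: closed_bigcup => [|i _]; [exact: finite_finset|exact: Dcl].
apply: filter_forall => i.
have [[c0 Dc0]|D0] := pselect (D i !=set0); last first.
  by near=> x => c Dc; case: D0; exists c.
have Cc0 : C c0 by exists i.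
have [p /metric_projP[Dp minp]] : metric_proj (D i) y !=set0.
  by apply: metric_proj_exists => //; exists c0.
have [w /metric_projP[Cw minw]] : metric_proj C y !=set0.
  by apply: metric_proj_exists => //; exists c0.
have Cp : C p by exists i.
have [pw|wp] := leP `|y - p| `|y - w|.
  near=> x => c _ _; exists p => //; apply/metric_projP; split=> // c' /minw.
  exact: le_trans.
near=> x => c Dc /metric_projP[_ /(_ _ Cw) xcw]; exfalso.
have xy : `|y - x| < (`|y - p| - `|y - w|) / 2.
  by near: x; apply: cvgr_dist_lt => //; rewrite divr_gt0// subr_gt0.
have yp := minp c Dc.
have h1 := ler_distD x y c; have h2 := ler_distD y x w.
have := distrC x y; lra.
Unshelve. all: by end_near. Qed.

End MetricProjection.

(** * Firm nonexpansiveness *)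

Section Firm.
Context {R : realType} {X : normedModType R} (dot : {dot X for idfun}).
Hypothesis norm_dot : forall x : X, `|x| = Num.sqrt (dot x x).
Implicit Types (x y z w : X) (D : set X).

Lemma dotC x y : dot x y = dot y x.
Proof.
by have := @hermitian_subproof _ _ _ _ dot x y; rewrite /= expr0 mul1r.
Qed.

Lemma norm_sqr_dot x : `|x| ^+ 2 = dot x x.
Proof.
rewrite norm_dot sqr_sqrtr//.
have [->|x0] := eqVneq x 0; first by rewrite linear0l.
by rewrite ltW// neq0_dnorm_gt0.
Qed.

Lemma dotDl x y z : dot (x + y) z = dot x z + dot y z. Proof. exact: linearDl. Qed.
Lemma dotNl x z : dot (- x) z = - dot x z. Proof. exact: linearNl. Qed.
Lemma dotDr x y z : dot z (x + y) = dot z x + dot z y. Proof. exact: linearDr. Qed.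
Lemma dotNr x z : dot z (- x) = - dot z x. Proof. exact: linearNr. Qed.
Lemma dotZl a x z : dot (a *: x) z = a * dot x z. Proof. exact: linearZl_LR. Qed.
Lemma dotZr a x z : dot z (a *: x) = a * dot z x. Proof. exact: linearZr_LR. Qed.

Let dotE := (dotDl, dotNl, dotDr, dotNr, dotZl, dotZr).

(** Firm nonexpansiveness of the graph points [(x, z)] and [(y, w)].  As a
    relation between four points it applies to set-valued maps.  The inner product
    form is equivalent to the inequality of [firm_norm], and with it
    [firm_douglas_rachford] is a plain addition of inequalities. *)
Definition firm x z y w := 0 <= dot (z - w) (x - y - (z - w)).

Lemma firm_norm x z y w : firm x z y w ->
  `|z - w| ^+ 2 + `|x - z - (y - w)| ^+ 2 <= `|x - y| ^+ 2.
Proof.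
rewrite /firm !norm_sqr_dot !dotE.
have := (dotC z x, dotC w x, dotC y x, dotC z y, dotC w y, dotC w z).
move=> [[[[[-> ->] ->] ->] ->] ->]; lra.
Qed.

Lemma firm_le x z y w : firm x z y w -> `|z - w| <= `|x - y|.
Proof.
move=> /firm_norm h; rewrite -(@ler_pXn2r _ 2)// ?nnegrE//.
by apply: le_trans h; rewrite lerDl sqr_ge0.
Qed.

(** The reflection [2 T - id] of a firmly nonexpansive map is nonexpansive. *)
Lemma firm_reflect_le x z y w : firm x z y w ->
  `|2 *: z - x - (2 *: w - y)| <= `|x - y|.
Proof.
move=> f; rewrite -(@ler_pXn2r _ 2)// ?nnegrE//; move: f.
rewrite /firm !norm_sqr_dot !dotE.
have := (dotC z x, dotC w x, dotC y x, dotC z y, dotC w y, dotC w z).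
move=> [[[[[-> ->] ->] ->] ->] ->]; lra.
Qed.

(** Otherwise moving from [p] towards [c] inside [D] would decrease the distance
    to [x]: the squared distance at [p + t (c - p)] is
    [`|x - p| ^+ 2 - 2 t s + t ^+ 2 q]. *)
Lemma metric_proj_obtuse D x p c :
  convex_set D -> metric_proj D x p -> D c -> dot (x - p) (c - p) <= 0.
Proof.
move=> Dcv /metric_projP[Dp minp] Dc; rewrite leNgt; apply/negP.
set s := dot _ _ => s0; pose q := `|c - p| ^+ 2.
have q0 : 0 <= q by exact: sqr_ge0.
have sq0 : 0 < s + q by lra.
(* The minimizer s / q may exceed 1; this smaller step lies in [0, 1] and
   still satisfies t * q < 2 * s. *)
pose t := s / (s + q).
have t0 : 0 <= t by rewrite divr_ge0// ltW.
have t1 : t <= 1 by rewrite ler_pdivrMr// mul1r lerDl.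
have : D (t *: c + (1 - t) *: p).
  have := Dcv c p (Itv01 t0 t1); rewrite !inE; exact.
move=> /minp; rewrite -(@ler_pXn2r _ 2)// ?nnegrE//.
rewrite (_ : x - (_ + _) = (x - p) - t *: (c - p)); last first.
  by rewrite scalerBl scale1r scalerBr addrCA opprD addrA.
rewrite !norm_sqr_dot [X in _ <= X](_ : _ = dot (x - p) (x - p) - 2 * t * s + t ^+ 2 * q).
  rewrite leNgt => /negP; apply.
  have : t * q < 2 * s.
    by rewrite /t mulrAC ltr_pdivrMr//; nra.
  have : 0 < t by rewrite divr_gt0.
  nra.
rewrite /q norm_sqr_dot !(dotDl (x - p)) !(dotDr (x - p)) !(dotNl, dotNr, dotZl, dotZr).
by rewrite (dotC (c - p) (x - p)) -/s; ring.
Qed.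

(** The sum of the obtuse angle conditions at [z] and at [w]. *)
Lemma metric_proj_firm D x z y w : convex_set D ->
  metric_proj D x z -> metric_proj D y w -> firm x z y w.
Proof.
move=> Dcv xz yw; have [Dz _] := (metric_projP _ _ _).1 xz.
have [Dw _] := (metric_projP _ _ _).1 yw.
have := metric_proj_obtuse Dcv xz Dw; have := metric_proj_obtuse Dcv yw Dz.
by rewrite /firm !dotE !(dotC z) !(dotC w); lra.
Qed.

Lemma firm_unique x z w : firm x z x w -> z = w.
Proof.
by move=> /firm_le; rewrite subrr normr0 normr_le0 subr_eq0 => /eqP.
Qed.

(** The Douglas-Rachford map is the average of the identity and the composition
    of two reflections.  With [d], [u], [v] the differences of the [x]s, [a]s and
    [b]s, the conclusion is exactly the sum of the two hypotheses. *)
Lemma firm_douglas_rachford x y a a' b b' :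
  firm x a y a' -> firm (2 *: a - x) b (2 *: a' - y) b' ->
  firm x (x + b - a) y (y + b' - a').
Proof.
rewrite /firm.
have -> : 2 *: a - x - (2 *: a' - y) = 2 *: (a - a') - (x - y).
  by rewrite scalerBr !opprD !opprK addrACA.
have -> : x + b - a - (y + b' - a') = (x - y) + (b - b') - (a - a').
  by rewrite opprD (opprD y) addrACA (addrACA x) -opprD.
move: (x - y) (a - a') (b - b') => d u v; rewrite !dotE.
rewrite ?(dotC u d) ?(dotC v d) ?(dotC v u); lra.
Qed.

End Firm.

(** * Local firm nonexpansiveness for union convex sets *)

Section LocallyFirm.
Context {R : realType} {X : normedVectType R} (dot : {dot X for idfun}).
Hypothesis norm_dot : forall x : X, `|x| = Num.sqrt (dot x x).
Implicit Types (x y z w : X) (A B C : set X) (T : X -> set X).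

(** The partner [w] depends on [x] and [z]: it plays the role of the value at [y]
    of the single-valued selection of [T] that sends [x] to [z]. *)
Definition locally_firm T y :=
  \forall x \near y, forall z, T x z -> exists2 w, T y w & firm dot x z y w.

(** Each convex piece contains at most one projection of [y]. *)
Lemma metric_proj_finite C y : union_convex C -> finite_set (metric_proj C y).
Proof.
move=> [k [D [Dcv ->]]].
apply: (@sub_finite_set _ _ (\bigcup_i (D i `&` metric_proj (\bigcup_i D i) y))).
  by move=> c Pc; have /metric_projP[[i _ Dic] _] := Pc; exists i.
apply: bigcup_finite => [|i _]; first exact: finite_finset.
have [[p [Dp Pp]]|noP] := pselect (D i `&` metric_proj (\bigcup_i D i) y !=set0).
  apply: (@sub_finite_set _ _ [set p]) => [c [Dc Pc] /=|]; last exact: finite_set1.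
  apply: (firm_unique norm_dot (x := y)).
  apply: metric_proj_firm (Dcv i).2 _ _ => //.
    by apply: metric_proj_subset Dc Pc => d Dd; exists i.
  by apply: metric_proj_subset Dp Pp => d Dd; exists i.
by apply: (@sub_finite_set _ _ set0) => // c Hc; case: noP; exists c.
Qed.

Lemma metric_proj_locally_firm C y :
  union_convex C -> locally_firm (metric_proj C) y.
Proof.
move=> [k [D [Dcv ->]]].
have := @metric_proj_active _ _ _ _ y (fun i => (Dcv i).1); apply: filterS.
move=> x act z Pz; have /metric_projP[[i _ Diz] _] := Pz.
have [p Dip Pp] := act _ _ Diz Pz; exists p => //.
have DiD : D i `<=` \bigcup_i D i by move=> d Dd; exists i.
by apply: metric_proj_firm (Dcv i).2 _ _ => //; apply: metric_proj_subset DiD _ _.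
Qed.

Lemma douglas_rachford_finite A B y :
  union_convex A -> union_convex B -> finite_set (douglas_rachford A B y).
Proof.
move=> uA uB; apply: finite_image.
rewrite (_ : [set _ | _] = \bigcup_(a in metric_proj A y)
    [set (a, b) | b in metric_proj B (2 *: a - y)]); last first.
  apply/seteqP; split=> [[a b]/= [Pa Pb]|_ [a Pa [b Pb <-]]//].
  by exists a => //; exists b.
apply: bigcup_finite => [|a _]; first exact: metric_proj_finite.
by apply: finite_image; exact: metric_proj_finite.
Qed.

(** The second projection is applied at [2 *: a - x], which is within [`|x - y|]
    of [2 *: a' - y] by [firm_reflect_le].  The radius on which the projection
    onto [B] is firm depends on [a'], and finiteness of the projections of [y]
    onto [A] provides a common one. *)
Lemma douglas_rachford_locally_firm A B y :
  union_convex A -> union_convex B -> locally_firm (douglas_rachford A B) y.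
Proof.
move=> uA uB; have /finite_fsetP[F PF] := metric_proj_finite y uA.
have nearB : \forall x \near y, forall a', metric_proj A y a' ->
    forall u, `|u - (2 *: a' - y)| <= `|x - y| -> forall b, metric_proj B u b ->
    exists2 b', metric_proj B (2 *: a' - y) b' & firm dot u b (2 *: a' - y) b'.
  pose good a' := [set x : X | forall u, `|u - (2 *: a' - y)| <= `|x - y| ->
    forall b, metric_proj B u b ->
    exists2 b', metric_proj B (2 *: a' - y) b' & firm dot u b (2 *: a' - y) b'].
  change (nbhs y (\bigcap_(a' in metric_proj A y) good a')).
  rewrite PF; apply: filter_bigI => a' _.
  have /nbhs_normP[e /= e0 He] := metric_proj_locally_firm (2 *: a' - y) uB.
  near=> x => u ux b Pb; apply: (He u _ b Pb) => /=.
  rewrite distrC; apply: le_lt_trans ux _; rewrite distrC.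
  by near: x; exact: cvgr_dist_lt.
have nearA := metric_proj_locally_firm y uA.
near=> x => _ [[a b] /= [Pa Pb] <-].
have [a' Pa' fa] : exists2 a', metric_proj A y a' & firm dot x a y a'.
  by move: a Pa {Pb}; near: x.
have [b' Pb' fb] : exists2 b', metric_proj B (2 *: a' - y) b' &
    firm dot (2 *: a - x) b (2 *: a' - y) b'.
  have : `|2 *: a - x - (2 *: a' - y)| <= `|x - y| by exact: firm_reflect_le.
  by move: (2 *: a - x) b Pb => u b Pb /[dup] ux _; move: a' {fa} Pa' u ux b Pb; near: x.
exists (y + b' - a'); last exact: firm_douglas_rachford.
by exists (a', b').
Unshelve. all: by end_near. Qed.

End LocallyFirm.

(** * Convergence of orbits *)

Section Convergence.
Context {R : realType} {X : normedVectType R} (dot : {dot X for idfun}).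
Hypothesis norm_dot : forall x : X, `|x| = Num.sqrt (dot x x).

(** The order in which the operators are used is arbitrary; the limit is fixed by
    those that occur infinitely often. *)
Lemma locally_firm_orbit_cvg (J : finType) (T : J -> X -> set X) (xstar : X) :
    (forall j y, finite_set (T j y)) ->
    (forall j y, locally_firm dot (T j) y) ->
    (forall j, T j xstar = [set xstar]) ->
  exists2 r : R, 0 < r & forall (x : nat -> X) (idx : nat -> J),
    (forall n, T (idx n) (x n) (x n.+1)) -> `|xstar - x 0%N| < r ->
    exists2 xbar : X, x @ \oo --> xbar &
      \forall n \near \oo, T (idx n) xbar xbar.
Proof.
move=> Tfin Tfirm Tstar.
have /nbhs_normP[r /= r0 Hr] : \forall x \near xstar, forall j z, T j x z ->
    firm dot x z xstar xstar.
  apply: filter_forall => j; have := Tfirm j xstar; apply: filterS.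
  by move=> x Hx z /Hx[w]; rewrite Tstar => ->.
exists r => // x idx Hx x0.
(* The orbit is Fejer monotone with respect to xstar. *)
have inball n : `|xstar - x n| < r.
  elim: n => // n IHn; apply: le_lt_trans (IHn).
  rewrite ![`|xstar - _|]distrC; apply: (firm_le norm_dot).
  exact: (Hr _ IHn _ _ (Hx n)).
pose d n := `|x n - xstar| ^+ 2.
have dec n : `|x n - x n.+1| ^+ 2 <= d n - d n.+1.
  have := firm_norm norm_dot (Hr _ (inball n) _ _ (Hx n)).
  by rewrite subrr subr0 /d; lra.
have dcvg : cvgn d.
  apply: nonincreasing_is_cvgn.
    apply/nonincreasing_seqP => n; rewrite -subr_ge0.
    by apply: le_trans (dec n); exact: sqr_ge0.
  by exists 0 => _ [n _ <-]; exact: sqr_ge0.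
have stepcvg : forall e : R, 0 < e -> \forall n \near \oo, `|x n - x n.+1| < e.
  move=> e e0.
  have : (d n - d n.+1) @[n --> \oo] --> (0 : R).
    rewrite -(subrr (limn d)); apply: cvgB => //.
    by rewrite (cvg_shiftS d).
  move=> /cvgrPdist_lt /(_ (e ^+ 2)); rewrite exprn_gt0// => /(_ isT).
  apply: filterS => n; rewrite sub0r normrN => h.
  rewrite -(@ltr_pXn2r _ 2)// ?nnegrE//; last exact: ltW.
  by apply: le_lt_trans (dec n) _; apply: le_lt_trans h; exact: ler_norm.
have [y [_ cly]] : (closed_ball_ Num.norm xstar r `&` cluster (x @ \oo)) !=set0.
  have := @closed_ball_compact _ _ xstar r.
  by apply; exists 0%N => // n _ /=; exact/ltW/inball.
have /nbhs_normP[e /= e0 He] : \forall x \near y, forall j z, T j x z ->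
    exists2 w, T j y w & firm dot x z y w.
  by apply: filter_forall => j; exact: Tfirm.
(* The points other than y in the finite union of the T j y are at distance at
   least s from y. *)
have [s s0 Hs] : exists2 s : R, 0 < s & forall j w, T j y w -> `|w - y| < s -> w = y.
  have Fy : closed ((\bigcup_j T j y) `\ y).
    apply: (accessible_finite_set_closed.1 (hausdorff_accessible (@norm_hausdorff _ X))).
    apply: finite_setD; apply: bigcup_finite => // j _; exact: Tfin.
  have : nbhs y (~` ((\bigcup_j T j y) `\ y)).
    apply: open_nbhs_nbhs; split; first exact: closed_openC.
    by move=> [_]; apply.
  move=> /nbhs_normP[s /= s0 Hs]; exists s => // j w Tw wy.
  apply: contrapT => wNy; apply: (Hs w) => /=; first by rewrite distrC.
  by split=> //; exists j.
pose q := Num.min e (s / 3).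
have q0 : 0 < q by rewrite lt_min e0 divr_gt0.
have [N _ HN] := stepcvg _ q0.
(* The partner w of x n.+1 is at distance < 3 * q <= s from y, passing through
   x n.+1 and x n: each of the three segments is shorter than q. *)
have close n p : p <= q -> (N <= n)%N -> `|x n - y| < p ->
    T (idx n) y y /\ `|x n.+1 - y| < p.
  move=> pq Nn xy.
  have qe : q <= e by rewrite ge_min lexx.
  have qs : q <= s / 3 by rewrite ge_min lexx orbT.
  have xe : `|y - x n| < e by rewrite distrC (lt_le_trans xy)// (le_trans pq).
  have [w Tw fw] := He _ xe _ _ (Hx n).
  have xw := firm_le norm_dot fw.
  suff wy : w = y by rewrite wy in Tw xw; split=> //; exact: le_lt_trans xy.
  apply: Hs Tw _.
  have step := HN n Nn; have wy := ler_distD (x n.+1) w y.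
  have xy1 := ler_distD (x n) (x n.+1) y.
  rewrite (distrC w (x n.+1)) in wy; rewrite (distrC (x n.+1) (x n)) in xy1.
  rewrite /= in step; lra.
have tail p : 0 < p -> p <= q ->
    \forall n \near \oo, T (idx n) y y /\ `|x n - y| < p.
  move=> p0 pq.
  have [_ [[M /= NM <-] Mp]] := cly (x @` [set n | (N <= n)%N]) (ball y p)
    (ltac:(by exists N => // n /= Nn; exists n)) (nbhsx_ballx _ _ p0).
  have xM : `|x M - y| < p by move: Mp; rewrite -ball_normE /= distrC.
  suff all k : `|x (M + k)%N - y| < p.
    exists M => // n /= Mn; rewrite -(subnKC Mn).
    by split=> //; apply: (close _ p pq _ (all _)).1; rewrite (leq_trans NM) ?leq_addr.
  elim: k => [|k IHk]; first by rewrite addn0.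
  by rewrite addnS; apply: (close _ p pq _ IHk).2; rewrite (leq_trans NM) ?leq_addr.
exists y; last by have := tail q q0 (lexx _); apply: filterS => n [].
apply/cvgrPdist_lt => p p0.
have : 0 < Num.min p q by rewrite lt_min p0.
move=> /tail; rewrite ge_min lexx orbT => /(_ isT); apply: filterS => n [_].
by rewrite lt_min distrC => /andP[].
Qed.

End Convergence.

(** * Fixed points of the Douglas-Rachford operator *)

Section Feasibility.
Context {R : realType} {X : normedModType R}.

Lemma douglas_rachford_common (A B : set X) x :
  A x -> B x -> douglas_rachford A B x = [set x].
Proof.
move=> Ax Bx; have xx : 2 *: x - x = x by rewrite scaler_nat mulr2n addrK.
rewrite /douglas_rachford metric_proj_id//; apply/seteqP; split=> [z|z ->].
  by move=> [[a b] /= [->]]; rewrite xx metric_proj_id// => -> <-; rewrite addrK.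
by exists (x, x) => /=; rewrite ?addrK// xx metric_proj_id.
Qed.

Lemma fix_douglas_rachford (A B : set X) x :
  fix_points (douglas_rachford A B) x ->
  exists2 c, metric_proj A x c & B c.
Proof.
move=> [[a b] /= [Pa /metric_projP[Bb _]]]; rewrite -addrA => /eqP.
rewrite -subr_eq0 addrAC subrr add0r subr_eq0 => /eqP ba.
by exists a; rewrite // -ba.
Qed.

End Feasibility.

Theorem theorem6p2 (R : realType) (X : normedVectType R)
    (dot : {dot X for idfun})
    (norm_dot : forall x : X, `|x| = Num.sqrt (dot x x))
    (m : nat) (m_ge2 : (2 <= m)%N) (C : nat -> set X)
    (C_nonempty : forall j, index_set m j -> C j !=set0)
    (C_union_convex : forall j, index_set m j -> union_convex (C j)) :
  (\bigcap_(j in index_set m) C j `<=`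
   \bigcap_(j in index_set m `\ 1%N)
     strong_fix_points (douglas_rachford (C 1%N) (C j))) /\
  (forall xstar : X,
     (\bigcap_(j in index_set m `\ 1%N)
        strong_fix_points (douglas_rachford (C 1%N) (C j))) xstar ->
     exists2 r : R, 0 < r &
       forall x : nat -> X,
         (forall n : nat,
            douglas_rachford (C 1%N) (C (n %% (m - 1) + 2)%N) (x n) (x n.+1)) ->
         interior (closed_ball_ Num.norm xstar r) (x 0%N) ->
         exists xbar : X,
           [/\ x @ \oo --> xbar,
               (\bigcap_(j in index_set m `\ 1%N)
                  fix_points (douglas_rachford (C 1%N) (C j))) xbar &
               convex_set (C 1%N) ->
               exists2 c : X, metric_proj (C 1%N) xbar = [set c] &
                 (\bigcap_(j in index_set m) C j) c]).
Proof.
have m1_gt0 : (0 < m - 1)%N by rewrite subn_gt0.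
have in1 : index_set m 1%N by rewrite /index_set/= (ltnW m_ge2).
split=> [x Cx j [jm _]|xstar xstarP].
  by apply: douglas_rachford_common; apply: Cx.
have inJ (j : 'I_(m - 1)) : (index_set m `\ 1%N) (j + 2)%N.
  split; last by rewrite /= addn2.
  by have := ltn_ord j; rewrite ltn_subRL /index_set/= addn2.
pose T (j : 'I_(m - 1)) := douglas_rachford (C 1%N) (C (j + 2)%N).
have uC (j : 'I_(m - 1)) : union_convex (C (j + 2)%N).
  by apply: C_union_convex; have [] := inJ j.
have [r r0 Hr] := @locally_firm_orbit_cvg R X dot norm_dot _ T xstar
  (fun j y => douglas_rachford_finite norm_dot y (C_union_convex _ in1) (uC j))
  (fun j y => douglas_rachford_locally_firm norm_dot y (C_union_convex _ in1) (uC j))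
  (fun j => xstarP _ (inJ j)).
exists r => // x Hx; rewrite -closed_ballE// interior_closed_ballE// -ball_normE /=.
pose idx n := Ordinal (ltn_pmod n m1_gt0).
move=> /(Hr x idx Hx)[xbar xcvg [N _ fixN]].
have xfix j : index_set m j -> j != 1%N ->
    fix_points (douglas_rachford (C 1%N) (C j)) xbar.
  move=> /andP[j1 jm] jn1.
  have j2 : (2 <= j)%N by rewrite ltn_neqAle j1 andbT eq_sym.
  (* A time after N at which the set of index j is used. *)
  have := fixN (N * (m - 1) + (j - 2))%N; rewrite /T /idx /= modnMDl.
  rewrite modn_small ?subnK//; last first.
    by rewrite ltn_subLR// addnBA ?(ltnW m_ge2)// add2n subn1.
  by apply; rewrite (leq_trans _ (leq_addr _ _))// leq_pmulr.
exists xbar; split=> // [j [jm /eqP j1]|C1cv]; first exact: xfix.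
have [c Pc _] := fix_douglas_rachford (xfix 2%N m_ge2 isT).
(* Convexity makes the projection onto C 1 unique, so the fixed point property
   yields the same point c for every index j. *)
have Puniq a : metric_proj (C 1%N) xbar a -> a = c.
  by move=> Pa; apply: (firm_unique norm_dot); exact: metric_proj_firm C1cv Pa Pc.
exists c; first by apply/seteqP; split=> [a /Puniq|_ ->].
move=> j jm; have [->|j1] := eqVneq j 1%N; first by have /metric_projP[] := Pc.
have [a /Puniq -> //] := fix_douglas_rachford (xfix j jm j1).
Qed.
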